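(* Let $T:V\to L$ be an $\mathcal{O}$-operator on a L.t.sRep pair $(L,[\cdot,\cdot,\cdot];\theta)$, with $\theta$ a representation on $V$. If two formal deformations $T_t=\sum_{i\ge0}T_it^i$ and $T'_t=\sum_{i\ge0}T'_it^i$ of $T$ are equivalent, then their infinitesimals $T_1$ and $T'_1$ are in the same cohomology class in $H_T^1(V;L)$.
   Context: All vector spaces are over a field $\mathbb{K}$ of characteristic $0$. A Lie triple system (L.t.s) is a vector space $L$ with a trilinear bracket $[\cdot,\cdot,\cdot]:\wedge^2L\otimes L\to L$ (skew-symmetric in the first two arguments) such that for all $x,y,z,t,e\in L$: $[x,y,z]+[y,z,x]+[z,x,y]=0$ and $[x,y,[z,t,e]]=[[x,y,z],t,e]+[z,[x,y,t],e]+[z,t,[x,y,e]]$. A morphism of L.t.s is a linear map preserving the ternary brackets. A representation of $L$ on a vector space $V$ is a bilinear map $\theta:\otimes^2L\to End(V)$ such that, with $D(x,y)=\theta(y,x)-\theta(x,y)$, for all $x,y,z,t\in L$: $\theta(z,t)\theta(x,y)-\theta(y,t)\theta(x,z)-\theta(x,[y,z,t])+D(y,z)\theta(x,t)=0$ and $\theta(z,t)D(x,y)-D(x,y)\theta(z,t)+\theta([x,y,z],t)+\theta(z,[x,y,t])=0$. A L.t.s together with a representation is called a L.t.sRep pair $(L,[\cdot,\cdot,\cdot];\theta)$. For $\mathfrak{X}=x\wedge y\in L\wedge L$ write $D(\mathfrak{X})=D(x,y)$, $[\mathfrak{X},z]=[x,y,z]$, extended linearly. A linear map $T:V\to L$ is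 an $\mathcal{O}$-operator on the pair if $[Tu,Tv,Tw]=T\big(D(Tu,Tv)w+\theta(Tv,Tw)u-\theta(Tu,Tw)v\big)$ for all $u,v,w\in V$. Then $V$ is a L.t.s under $[u,v,w]_T=D(Tu,Tv)w+\theta(Tv,Tw)u-\theta(Tu,Tw)v$, and $\theta_T(u,v)x=[x,Tu,Tv]+T\big(\theta(x,Tv)u-D(x,Tu)v\big)$ is a representation of it on $L$; put $D_T(u,v)=\theta_T(v,u)-\theta_T(u,v)$. A morphism from an $\mathcal{O}$-operator $T$ to an $\mathcal{O}$-operator $T'$ on the same pair is a pair $(\phi,\psi)$ of a L.t.s morphism $\phi:L\to L$ and a linear map $\psi:V\to V$ with $\phi\circ T=T'\circ\psi$ and $\psi\,\theta(x,y)=\theta(\phi(x),\phi(y))\,\psi$ for all $x,y\in L$. $Z_T^1(V,L)$ is the space of linear maps $f:V\to L$ with $D_T(v_1,v_2)f(v_3)-\theta_T(v_1,v_3)f(v_2)+\theta_T(v_2,v_3)f(v_1)-f([v_1,v_2,v_3]_T)=0$ for all $v_i\in V$; $B_T^1(V,L)=\{d_T\mathfrak{X}\mid\mathfrak{X}\in L\wedge L\}$ where $(d_T\mathfrak{X})(v)=TD(\mathfrak{X})v-[\mathfrak{X},Tv]$; and $H_T^1(V;L)=Z_T^1(V,L)/B_T^1(V,L)$. The bracket of $L$ and $\theta$, $D$ are extended $\mathbb{K}[[t]]$-multilinearly (coefficientwise, by Cauchy product) to $L[[t]]$, $V[[t]]$. A formal deformation of $T$ is a power series $T_t=\sum_{i\ge0}T_it^i$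 with $T_i\in Hom_{\mathbb{K}}(V,L)$, $T_0=T$, satisfying $[T_t(u),T_t(v),T_t(w)]=T_t\big(D(T_t(u),T_t(v))w+\theta(T_t(v),T_t(w))u-\theta(T_t(u),T_t(w))v\big)$ for all $u,v,w\in V$. Its infinitesimal is $T_1$, which is a $1$-cocycle. Two formal deformations $T_t$, $T'_t$ of $T$ are equivalent if there exist $\mathfrak{X}\in L\wedge L$, $\phi_i\in gl(L)$, $\psi_i\in gl(V)$ ($i\ge2$) such that $\big(\phi_t=Id_L+t[\mathfrak{X},-]+\sum_{i\ge2}\phi_it^i,\ \psi_t=Id_V+tD(\mathfrak{X})(-)+\sum_{i\ge2}\psi_it^i\big)$ is a morphism of $\mathcal{O}$-operators (over $\mathbb{K}[[t]]$) from $T_t$ to $T'_t$. *)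

(* Defs.v *)
From HB Require Import structures.
From mathcomp Require Import all_boot all_order all_algebra.
From mathcomp Require Import boolp classical_sets.

Set Implicit Arguments.
Unset Strict Implicit.
Unset Printing Implicit Defensive.

Import GRing.Theory.
Local Open Scope ring_scope.
Local Open Scope quotient_scope.

Section ExteriorSquare.
Variables (K : fieldType) (L : lmodType K).

Record alternating_bilinear (W : lmodType K) (f : L -> L -> W) : Prop := {
  alt_linearl : forall y, linear (fun x => f x y);
  alt_linearr : forall x, linear (f x);
  alt_diag : forall x, f x x = 0 }.

Definition eval_sum (W : lmodType K) (f : L -> L -> W) (s : seq (L * L)) : W :=
  \sum_(p <- s) f p.1 p.2.

(* A sequence (x_1,y_1), ..., (x_n,y_n) stands for the sum of the x_i /\ y_i.
   Two such sums are equal in the exterior square iff no alternating bilinear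
   map distinguishes them (universal property).                             *)
Definition ext2_rel (s1 s2 : seq (L * L)) : bool :=
  `[< forall (W : lmodType K) (f : L -> L -> W),
        alternating_bilinear f -> eval_sum f s1 = eval_sum f s2 >].

Lemma ext2_rel_equiv : equiv_class_of ext2_rel.
Proof.
split=> [s|s1 s2|s2 s1 s3]; first exact/asboolP.
- by apply/asboolP/asboolP => h W f af; rewrite h.
- by move=> /asboolP h1 /asboolP h2; apply/asboolP => W f af; rewrite h1 ?h2.
Qed.

Canonical ext2_equiv_rel := EquivRelPack ext2_rel_equiv.

Definition ext2 := {eq_quot ext2_rel}.
HB.instance Definition _ := Choice.on ext2.
HB.instance Definition _ := EqQuotient.on ext2.

(* The linear map induced on the exterior square by f, meaningful only for
   alternating bilinear f: see ext2_lift_pi.                                *)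
Definition ext2_lift (W : lmodType K) (f : L -> L -> W) (X : ext2) : W :=
  eval_sum f (repr X).

Definition wedge (x y : L) : ext2 := \pi_ext2 [:: (x, y)].

Lemma ext2_lift_pi (W : lmodType K) (f : L -> L -> W) s :
  alternating_bilinear f -> ext2_lift f (\pi_ext2 s) = eval_sum f s.
Proof.
move=> af; have /eqmodP/asboolP : repr (\pi_ext2 s) = s %[mod ext2].
  by rewrite reprK.
exact.
Qed.

Lemma ext2_lift_wedge (W : lmodType K) (f : L -> L -> W) x y :
  alternating_bilinear f -> ext2_lift f (wedge x y) = f x y.
Proof. by move=> af; rewrite ext2_lift_pi // /eval_sum big_seq1. Qed.

Lemma ext2_eqP (X Y : ext2) :
  (forall (W : lmodType K) (f : L -> L -> W),
     alternating_bilinear f -> ext2_lift f X = ext2_lift f Y) -> X = Y.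
Proof.
move=> h; rewrite -[X]reprK -[Y]reprK; apply/eqmodP/asboolP => W f af.
exact: h.
Qed.

Definition ext2_zero : ext2 := \pi_ext2 [::].
Definition ext2_scale (a : K) (X : ext2) : ext2 :=
  \pi_ext2 [seq (a *: p.1, p.2) | p <- repr X].
Definition ext2_opp (X : ext2) : ext2 := ext2_scale (-1) X.
Definition ext2_add (X Y : ext2) : ext2 := \pi_ext2 (repr X ++ repr Y).

Section LiftOps.
Variables (W : lmodType K) (f : L -> L -> W).
Hypothesis af : alternating_bilinear f.

Lemma ext2_lift_zero : ext2_lift f ext2_zero = 0.
Proof. by rewrite ext2_lift_pi // /eval_sum big_nil. Qed.

Lemma ext2_lift_scale a X : ext2_lift f (ext2_scale a X) = a *: ext2_lift f X.
Proof.
rewrite ext2_lift_pi // /ext2_lift /eval_sum big_map scaler_sumr.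
apply: eq_bigr => p _ /=.
have := alt_linearl af p.2 a p.1 0.
have f0 : f 0 p.2 = 0.
  by have := alt_linearl af p.2 (-1) 0 0; rewrite scaler0 addr0 scaleN1r addNr.
by rewrite addr0 f0 addr0.
Qed.

Lemma ext2_lift_add X Y :
  ext2_lift f (ext2_add X Y) = ext2_lift f X + ext2_lift f Y.
Proof. by rewrite ext2_lift_pi // /eval_sum big_cat. Qed.

Lemma ext2_lift_opp X : ext2_lift f (ext2_opp X) = - ext2_lift f X.
Proof. by rewrite ext2_lift_scale scaleN1r. Qed.
End LiftOps.

Definition ext2_liftE :=
  (ext2_lift_zero, ext2_lift_scale, ext2_lift_add, ext2_lift_opp).

Lemma ext2_addA : associative ext2_add.
Proof. by move=> X Y Z; apply: ext2_eqP => W f af; rewrite !ext2_liftE ?addrA. Qed.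
Lemma ext2_addC : commutative ext2_add.
Proof. by move=> X Y; apply: ext2_eqP => W f af; rewrite !ext2_liftE // addrC. Qed.
Lemma ext2_add0 : left_id ext2_zero ext2_add.
Proof. by move=> X; apply: ext2_eqP => W f af; rewrite !ext2_liftE // add0r. Qed.
Lemma ext2_addN : left_inverse ext2_zero ext2_opp ext2_add.
Proof. by move=> X; apply: ext2_eqP => W f af; rewrite !ext2_liftE // addNr. Qed.

HB.instance Definition _ :=
  GRing.isZmodule.Build ext2 ext2_addA ext2_addC ext2_add0 ext2_addN.

Lemma ext2_scaleA a b X : ext2_scale a (ext2_scale b X) = ext2_scale (a * b) X.
Proof. by apply: ext2_eqP => W f af; rewrite !ext2_liftE // scalerA. Qed.
Lemma ext2_scale1 : left_id 1 ext2_scale.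
Proof. by move=> X; apply: ext2_eqP => W f af; rewrite !ext2_liftE // scale1r. Qed.
Lemma ext2_scaleDr : right_distributive ext2_scale +%R.
Proof.
by move=> a X Y; apply: ext2_eqP => W f af; rewrite !ext2_liftE // scalerDr.
Qed.
Lemma ext2_scaleDl X : {morph ext2_scale^~ X : a b / a + b}.
Proof.
by move=> a b; apply: ext2_eqP => W f af; rewrite !ext2_liftE // scalerDl.
Qed.

HB.instance Definition _ := GRing.Zmodule_isLmodule.Build K ext2
  ext2_scaleA ext2_scale1 ext2_scaleDr ext2_scaleDl.

Lemma ext2_lift_linear (W : lmodType K) (f : L -> L -> W) :
  alternating_bilinear f -> linear (ext2_lift f).
Proof. by move=> af a X Y; rewrite ext2_lift_add // ext2_lift_scale. Qed.

End ExteriorSquare.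

Arguments ext2 {K} L.

Record lts (K : fieldType) (L : lmodType K) := Lts {
  bracket :> L -> L -> L -> L;
  bracket_linear1 : forall y z, linear (fun x => bracket x y z);
  bracket_linear2 : forall x z, linear (fun y => bracket x y z);
  bracket_linear3 : forall x y, linear (bracket x y);
  bracket_skew : forall x y z, bracket x y z = - bracket y x z;
  bracket_cyclic : forall x y z,
    bracket x y z + bracket y z x + bracket z x y = 0;
  bracket_fundamental : forall x y z t e,
    bracket x y (bracket z t e) =
      bracket (bracket x y z) t e + bracket z (bracket x y t) e
      + bracket z t (bracket x y e) }.

Definition Dop (K : fieldType) (L V : lmodType K) (theta : L -> L -> V -> V)
  (x y : L) (v : V) : V := theta y x v - theta x y v.

Record ltsrep (K : fieldType) (L : lmodType K) (br : lts L) (V : lmodType K) :=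
  LtsRep {
  theta :> L -> L -> V -> V;
  theta_linear1 : forall y v, linear (fun x => theta x y v);
  theta_linear2 : forall x v, linear (fun y => theta x y v);
  theta_linear3 : forall x y, linear (theta x y);
  theta_rep1 : forall x y z t v,
    theta z t (theta x y v) - theta y t (theta x z v) - theta x (br y z t) v
    + Dop theta y z (theta x t v) = 0;
  theta_rep2 : forall x y z t v,
    theta z t (Dop theta x y v) - Dop theta x y (theta z t v)
    + theta (br x y z) t v + theta z (br x y t) v = 0 }.

Section OOperators.
Variables (K : fieldType) (L V : lmodType K) (br : lts L) (th : ltsrep br V).

Let D := Dop th.

(* [X, z] and D(X) for X in the exterior square. *)
Definition bracket_ext (X : ext2 L) (z : L) : L :=
  ext2_lift (fun x y => br x y z) X.
Definition Dop_ext (X : ext2 L) (v : V) : V :=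
  ext2_lift (fun x y => D x y v) X.

Lemma skew_diag (W : lmodType K) (w : W) : [pchar K] =i pred0 -> w = - w -> w = 0.
Proof.
move=> charK /eqP; rewrite -addr_eq0 -mulr2n -scaler_nat scaler_eq0.
by have /pcharf0P -> := charK => /eqP.
Qed.

(* With ext2_lift_linear, the next two lemmas show that bracket_ext and Dop_ext
   are the linear extensions of the bracket and of D.                       *)
Lemma bracket_alternating z :
  [pchar K] =i pred0 -> alternating_bilinear (fun x y => br x y z).
Proof.
move=> charK; split=> [y|x|x]; first exact: bracket_linear1.
- exact: bracket_linear2.
- by apply: skew_diag => //; rewrite -bracket_skew.
Qed.

Lemma Dop_alternating v : alternating_bilinear (fun x y => D x y v).
Proof.
split=> [y a x x'|x a y y'|x]; rewrite /D /Dop ?subrr //.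
- by rewrite (theta_linear1 th) (theta_linear2 th) scalerBr opprD addrACA.
- by rewrite (theta_linear1 th) (theta_linear2 th) scalerBr opprD addrACA.
Qed.

Section Cohomology.
Variable T : {linear V -> L}.

Definition bracket_T (u v w : V) : V :=
  D (T u) (T v) w + th (T v) (T w) u - th (T u) (T w) v.

Definition O_operator : Prop :=
  forall u v w, br (T u) (T v) (T w) = T (bracket_T u v w).

Definition theta_T (u v : V) (x : L) : L :=
  br x (T u) (T v) + T (th x (T v) u - D x (T u) v).

Definition D_T (u v : V) (x : L) : L := theta_T v u x - theta_T u v x.

Definition cocycle1 (f : {linear V -> L}) : Prop :=
  forall v1 v2 v3,
    D_T v1 v2 (f v3) - theta_T v1 v3 (f v2) + theta_T v2 v3 (f v1)
    - f (bracket_T v1 v2 v3) = 0.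

Definition d_T (X : ext2 L) (v : V) : L := T (Dop_ext X v) - bracket_ext X (T v).

Definition coboundary1 (f : {linear V -> L}) : Prop :=
  exists X : ext2 L, f =1 d_T X.

(* An element of H^1 is a coset f + B^1 with f in Z^1. *)
Record H1 := {
  coset1 : set {linear V -> L};
  coset1P : exists2 f, cocycle1 f
              & coset1 = [set g : {linear V -> L} | coboundary1 (g \- f)]%classic }.

End Cohomology.

(* The element (m_n)_n of nat -> M stands for the power series of the m_n t^n
   in M[[t]]; equality of series is =1, sum and difference are \+ and \-.    *)
Definition const_series (M : lmodType K) (m : M) : nat -> M :=
  fun n => if n is 0%N then m else 0.

Definition app_series (M N : lmodType K) (F : nat -> {linear M -> N})
  (u : nat -> M) : nat -> N :=
  fun n => \sum_(i < n.+1) F i (u (n - i)%N).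

Definition trilinear_series (M1 M2 M3 N : lmodType K) (m : M1 -> M2 -> M3 -> N)
  (x : nat -> M1) (y : nat -> M2) (z : nat -> M3) : nat -> N :=
  fun n => \sum_(i < n.+1) \sum_(j < (n - i).+1) m (x i) (y j) (z (n - i - j)%N).

Let brt := trilinear_series br.
Let tht := trilinear_series th.
Let Dt := trilinear_series D.

Definition O_operator_series (Tt : nat -> {linear V -> L}) : Prop :=
  forall u0 v0 w0 : V,
    let u := const_series u0 in
    let v := const_series v0 in
    let w := const_series w0 in
    let Tu := app_series Tt u in
    let Tv := app_series Tt v in
    let Tw := app_series Tt w in
    brt Tu Tv Tw =1 app_series Tt (Dt Tu Tv w \+ tht Tv Tw u \- tht Tu Tw v).

Definition formal_deformation (T : {linear V -> L})
  (Tt : nat -> {linear V -> L}) : Prop :=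
  Tt 0%N =1 T /\ O_operator_series Tt.

Definition infinitesimal (Tt : nat -> {linear V -> L}) : {linear V -> L} := Tt 1%N.

Record O_morphism_series (Tt Tt' : nat -> {linear V -> L})
  (phi : nat -> {linear L -> L}) (psi : nat -> {linear V -> V}) : Prop := {
  phi_bracket : forall x y z : nat -> L,
    app_series phi (brt x y z) =1
      brt (app_series phi x) (app_series phi y) (app_series phi z);
  phi_T : forall v : nat -> V,
    app_series phi (app_series Tt v) =1 app_series Tt' (app_series psi v);
  psi_theta : forall (x y : nat -> L) (v : nat -> V),
    app_series psi (tht x y v) =1
      tht (app_series phi x) (app_series phi y) (app_series psi v) }.

Definition equivalent_deformations (Tt Tt' : nat -> {linear V -> L}) : Prop :=
  exists (X : ext2 L) (phi : nat -> {linear L -> L})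
         (psi : nat -> {linear V -> V}),
    [/\ phi 0%N =1 id, phi 1%N =1 bracket_ext X,
        psi 0%N =1 id, psi 1%N =1 Dop_ext X
      & O_morphism_series Tt Tt' phi psi].

End OOperators.

(* Main.v *)
Require Import Defs.
From HB Require Import structures.
From mathcomp Require Import all_boot all_order all_algebra.
From mathcomp Require Import boolp classical_sets.

(** Everything happens in degree one.

    The O-operator equation for [T_t] modulo [t^2] is, in degree one, the
    linearisation of the O-operator equation at [T] in the direction [T_1]
    ([O_operator_linearized]).  After the operators [theta_T] and [D_T] are
    unfolded and [D_T] is simplified by the cyclic identity ([D_TE]), this
    linearisation is the 1-cocycle condition ([linearized_cocycle1]); hence
    every infinitesimal is a 1-cocycle, and its coset modulo coboundaries is a
    cohomology class.

    An equivalence [(phi_t, psi_t)] with [phi_1 = [X, -]] and [psi_1 = D(X)]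
    satisfies [phi_t T_t = T'_t psi_t], whose degree-one part reads
    [T_1 + [X, T -] = T'_1 + T D(X)].  So [T'_1 - T_1] is the coboundary of
    [-X] ([equivalent_infinitesimals]), and [T_1], [T'_1] lie in the same
    coset. *)

Set Implicit Arguments.
Unset Strict Implicit.
Unset Printing Implicit Defensive.

Import GRing.Theory.
Local Open Scope ring_scope.

Section LowDegree.
Variable K : fieldType.

Lemma app_series1 (M N : lmodType K) (F : nat -> {linear M -> N}) u :
  app_series F u 1%N = F 0%N (u 1%N) + F 1%N (u 0%N).
Proof. by rewrite /app_series !big_ord_recl big_ord0 addr0. Qed.

Lemma app_series_const (M N : lmodType K) (F : nat -> {linear M -> N}) (m : M) n :
  app_series F (const_series m) n = F n m.
Proof.
rewrite /app_series big_ord_recr /= subnn big1 ?add0r // => i _.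
by have := ltn_ord i; rewrite -subn_gt0; case: (n - i)%N => // k _; rewrite linear0.
Qed.

Variables (M1 M2 M3 N : lmodType K) (m : M1 -> M2 -> M3 -> N).

Lemma trilinear_series0 x y z :
  trilinear_series m x y z 0%N = m (x 0%N) (y 0%N) (z 0%N).
Proof. by rewrite /trilinear_series !(big_ord_recl, big_ord0) /= !addr0. Qed.

Lemma trilinear_series1 x y z :
  trilinear_series m x y z 1%N =
    m (x 0%N) (y 0%N) (z 1%N) + m (x 0%N) (y 1%N) (z 0%N)
    + m (x 1%N) (y 0%N) (z 0%N).
Proof. by rewrite /trilinear_series !(big_ord_recl, big_ord0) /= !addr0. Qed.

End LowDegree.

Section Infinitesimals.
Variables (K : fieldType) (L V : lmodType K) (br : lts L) (th : ltsrep br V).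

Lemma Dop_skew x y v : Dop th x y v = - Dop th y x v.
Proof. by rewrite /Dop opprB. Qed.

Lemma theta_0 x y : th x y 0 = 0.
Proof.
by have := theta_linear3 th x y (-1) 0 0; rewrite scaler0 addr0 scaleN1r addNr.
Qed.

Lemma Dop_0 x y : Dop th x y 0 = 0.
Proof. by rewrite /Dop !theta_0 subrr. Qed.

Section Cocycle.
Variables (T f : {linear V -> L}).

(** The brackets of [theta_T v u] and [theta_T u v] combine by the cyclic
    identity; the terms [theta x (T u) v] and [theta x (T v) u], which occur
    once as such and once inside [D], cancel. *)
Lemma D_TE u v x :
  D_T th T u v x = br (T u) (T v) x + T (th (T u) x v - th (T v) x u).
Proof.
have -> : br (T u) (T v) x = br x (T v) (T u) - br x (T u) (T v).
  have := bracket_cyclic br (T u) (T v) x.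
  rewrite (bracket_skew br (T v)) -addrA => /eqP; rewrite addr_eq0 => /eqP ->.
  by rewrite opprD opprK.
rewrite /D_T /theta_T (opprD (br x (T u) (T v))) addrACA -linearB; congr (_ + T _).
rewrite /Dop !opprB !addrA.
by rewrite [LHS](ACl (4*3*(1*5)*(2*6)))/= !subrr !addr0.
Qed.

(** Derivative of the O-operator equation at [T] in the direction [f]. *)
Definition O_operator_linearized : Prop := forall u v w,
  br (T u) (T v) (f w) + br (T u) (f v) (T w) + br (f u) (T v) (T w) =
  T (Dop th (T u) (f v) w + Dop th (f u) (T v) w
     + (th (T v) (f w) u + th (f v) (T w) u)
     - (th (T u) (f w) v + th (f u) (T w) v))
  + f (bracket_T th T u v w).

Lemma linearized_cocycle1 : O_operator_linearized -> cocycle1 th T f.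
Proof.
move=> h u v w; move/eqP: (h u v w); rewrite -subr_eq0 => /eqP <-.
rewrite D_TE /theta_T (bracket_skew br (f v)) (Dop_skew (f v) (T u)).
(* Only linearity of [T] is left; the abstraction keeps [Dop] folded. *)
move: (br _ _ (f w)) (br _ _ (T w)) (br (f u) _ _).
move: (f (bracket_T _ _ _ _ _)).
move: (Dop th (T u) _ _) (Dop th (f u) _ _).
move: (th (T u) _ _) (th (T v) _ _) (th (f v) _ _) (th (f u) _ _).
move=> p q r m s n z a b c.
rewrite opprD !opprK opprD !addrA; congr (_ - _).
rewrite [LHS](ACl (1*3*5*(2*4*6)))/=.
rewrite -linearB -linearD -linearN; congr (_ + T _).
by rewrite opprB !opprD !addrA [LHS](ACl (1*5*4*6*2*3))/=.
Qed.

End Cocycle.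

Lemma infinitesimal_cocycle1 (T : {linear V -> L}) (Tt : nat -> {linear V -> L}) :
  formal_deformation th T Tt -> cocycle1 th T (infinitesimal Tt).
Proof.
case=> T0 hTt; apply: linearized_cocycle1 => u v w.
have := hTt u v w 1%N.
rewrite app_series1 /= !trilinear_series1 !trilinear_series0.
by rewrite !app_series_const /= !T0 !theta_0 Dop_0 !add0r => ->.
Qed.

Hypothesis charK : [pchar K] =i pred0.

(** The characteristic enters here: skew-symmetry alone makes the bracket
    alternating, hence extendable to the exterior square, when 2 is
    invertible. *)
Lemma d_T_linear (T : {linear V -> L}) v : linear (fun X => d_T th T X v).
Proof.
move=> a X Y; rewrite /d_T /Dop_ext /bracket_ext.
rewrite (ext2_lift_linear (Dop_alternating th v)).
rewrite (ext2_lift_linear (bracket_alternating br (T v) charK)).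
by rewrite linearP scalerBr opprD addrACA.
Qed.

Lemma d_T0 (T : {linear V -> L}) v : d_T th T 0 v = 0.
Proof.
by have := d_T_linear T v (-1) 0 0; rewrite scaler0 addr0 scaleN1r addNr.
Qed.

Lemma d_TN (T : {linear V -> L}) X v : d_T th T (- X) v = - d_T th T X v.
Proof.
by have := d_T_linear T v (-1) X 0; rewrite !scaleN1r !addr0 d_T0 addr0.
Qed.

Lemma equivalent_infinitesimals (T : {linear V -> L})
    (Tt Tt' : nat -> {linear V -> L}) :
    Tt 0%N =1 T -> Tt' 0%N =1 T -> equivalent_deformations th Tt Tt' ->
  coboundary1 th T (infinitesimal Tt' \- infinitesimal Tt).
Proof.
move=> T0 T0' [X [phi [psi [phi0 phi1 psi0 psi1 [_ hT _]]]]].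
exists (- X) => v; rewrite d_TN /d_T opprB /=.
have := hT (const_series v) 1%N.
rewrite app_series1 [RHS]app_series1 !app_series_const phi0 phi1 psi0 psi1 T0 T0' => h.
by apply/eqP; rewrite subr_eq addrAC [_ + Tt 1%N v]addrC h addrAC subrr add0r.
Qed.

End Infinitesimals.

Theorem theorem5p4 (K : fieldType) (charK : [pchar K] =i pred0)
  (L V : lmodType K) (br : lts L) (th : ltsrep br V)
  (T : {linear V -> L}) (hT : O_operator th T)
  (Tt Tt' : nat -> {linear V -> L})
  (hTt : formal_deformation th T Tt)
  (hTt' : formal_deformation th T Tt')
  (heq : equivalent_deformations th Tt Tt') :
  exists c : H1 th T, coset1 c (infinitesimal Tt) /\ coset1 c (infinitesimal Tt').
Proof.
have cT1 := infinitesimal_cocycle1 hTt.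
exists (Build_H1 (ex_intro2 _ _ (infinitesimal Tt) cT1 erefl)) => /=; split.
  by exists 0 => v; rewrite d_T0 //= subrr.
exact: equivalent_infinitesimals hTt.1 hTt'.1 heq.
Qed.
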